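(* Let $m\ge2$ be an integer and $a,b$ complex numbers. Let $f_m(z,a,b)=\sum_{n\ge0}c(n,m,a,b)z^n$ be the unique formal power series with $f_m=1+azf_m+bz^mf_m^2$, and $d_0^{(m)}(N,a,b)=\det\big(c(i+j,m,a,b)\big)_{i,j=0}^{N-1}$. Then for all $n\ge0$ $$d_0^{(m)}(mn,a,b)=(-1)^{\binom{m-1}2n}b^{n(mn-1)},\qquad d_0^{(m)}(mn+1,a,b)=(-1)^{\binom{m-1}2n}b^{n(mn+1)},$$ and $d_0^{(m)}(N,a,b)=0$ for all $N\ge0$ not of the form $mn$ or $mn+1$.
   Context: The determinant of a $0\times0$ matrix is $1$. *)

(* Defs.v *)
From HB Require Import structures.
From mathcomp Require Import all_boot all_order all_algebra.
From mathcomp Require Import reals complex.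
Set Implicit Arguments.
Unset Strict Implicit.
Unset Printing Implicit Defensive.
Import GRing.Theory.
Local Open Scope ring_scope.

(* A formal power series is its coefficient sequence; two series are equal    *)
(* when their coefficients agree pointwise ([=1]).                            *)
Definition fps (K : comNzRingType) := nat -> K.

Section FPS.
Variable K : comNzRingType.
Implicit Types (f g : fps K) (a b : K).

Definition fps_monom (k : nat) : fps K := fun n => (n == k)%:R.
Definition fps_one : fps K := fps_monom 0.
Definition fps_add f g : fps K := fun n => f n + g n.
Definition fps_scale a f : fps K := fun n => a * f n.
Definition fps_mul f g : fps K := fun n => \sum_(i < n.+1) f i * g (n - i)%N.

End FPS.

Arguments fps_monom {K} k _.
Arguments fps_one {K} _.

Declare Scope fps_scope.
Delimit Scope fps_scope with fps.
Bind Scope fps_scope with fps.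
Notation "1" := fps_one : fps_scope.
Notation "''z^' k" := (fps_monom k) (at level 1, k at level 1, format "''z^' k") : fps_scope.
Notation "f + g" := (fps_add f g) : fps_scope.
Notation "f * g" := (fps_mul f g) : fps_scope.
Notation "a *: f" := (fps_scale a f) : fps_scope.

Section Equation.
Variable K : comNzRingType.
Implicit Types (f g : fps K) (a b : K).

Definition fm_rhs (m : nat) a b f : fps K :=
  (1 + a *: ('z^1 * f) + b *: ('z^m * (f * f)))%fps.

Definition is_fm (m : nat) a b f : Prop := f =1 fm_rhs m a b f.

Definition hankel_det f (N : nat) : K := \det (\matrix_(i < N, j < N) f (i + j)%N).

(* Well-definedness: for m > 0 the equation has exactly one solution.         *)

Lemma fps_mul_monom k f n : (0 < k)%N ->
  fps_mul (fps_monom k) f n = if (k <= n)%N then f (n - k)%N else 0.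
Proof.
move=> k_gt0; rewrite /fps_mul /fps_monom; case: leqP => [le_kn | lt_nk].
  rewrite (bigD1 (Ordinal (le_kn : (k < n.+1)%N))) //= eqxx mul1r big1 ?addr0 //.
  move=> i; rewrite -val_eqE /= => /negbTE ->; exact: mul0r.
apply: big1 => i _; rewrite ltn_eqF ?mul0r //.
by apply: leq_ltn_trans lt_nk; rewrite -ltnS.
Qed.

Lemma fm_rhs_local m a b f g n : (0 < m)%N ->
  (forall k, (k < n)%N -> f k = g k) -> fm_rhs m a b f n = fm_rhs m a b g n.
Proof.
move=> m_gt0 eq_fg; rewrite /fm_rhs /fps_add /fps_scale !fps_mul_monom //.
have lt_sub k : (0 < k)%N -> (k <= n)%N -> (n - k < n)%N.
  by move=> k0 kn; rewrite ltn_subrL k0 (leq_trans k0 kn).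
congr (_ + _ * _ + _ * _); case: leqP => // le_n; first by rewrite eq_fg ?lt_sub.
rewrite /fps_mul; apply: eq_bigr => i _.
have le_i : (i <= n - m)%N by rewrite -ltnS.
by rewrite !eq_fg // (leq_ltn_trans _ (lt_sub _ m_gt0 le_n)) // leq_subr.
Qed.

Lemma is_fm_unique m a b f g : (0 < m)%N ->
  is_fm m a b f -> is_fm m a b g -> f =1 g.
Proof.
move=> m_gt0 Ef Eg n; elim/ltn_ind: n => n IHn.
by rewrite Ef Eg; apply: fm_rhs_local.
Qed.

Lemma is_fm_exists m a b : (0 < m)%N -> exists f, is_fm m a b f.
Proof.
move=> m_gt0.
pose G := fix G n : seq K :=
  if n is n'.+1 then rcons (G n') (fm_rhs m a b (nth 0 (G n')) n') else [::].
have sG n : size (G n) = n by elim: n => //= n IH; rewrite size_rcons IH.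
have GE n k : (k < n)%N -> nth 0 (G n) k = fm_rhs m a b (nth 0 (G k)) k.
  elim: n => // n IH; rewrite /= ltnS leq_eqVlt nth_rcons sG.
  by case/predU1P=> [-> | lt_kn]; rewrite ?ltnn ?eqxx // lt_kn IH.
exists (fun n => nth 0 (G n.+1) n) => n; rewrite GE //.
by apply: fm_rhs_local => // k lt_kn; rewrite !GE.
Qed.

End Equation.

(* Main.v *)
Require Import Defs.
From HB Require Import structures.
From mathcomp Require Import all_boot all_order all_algebra.
From mathcomp Require Import reals complex.
From mathcomp Require Import zify ring.
Import GRing.Theory.
Local Open Scope ring_scope.
Local Open Scope complex_scope.

(** Put [u = 1/f = 1 - a z - b z^m f].  If [L] and [F] are the unitriangular
    Toeplitz matrices of [u] and [f], and [H] is the Hankel matrix of [z^s f],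
    then [L H = C F], where [C] is block diagonal: its first block, of size
    [s + 1], has entries [u_(i+j-s)] and is anti-triangular with ones on the
    antidiagonal; the second one is the Hankel matrix of [- u_(n+s+2)].  Since
    [u_n = - b f_(n-m)] for [n >= 2], the case [s = 0] leads from [f] to
    [b z^(m-2) f], and then the case [s = m - 2] leads back to [b f]; together
    they express the determinant of order [N] through that of order [N - m]. *)

Section Hankel.
Set Implicit Arguments.
Unset Strict Implicit.
Variable K : comNzRingType.
Implicit Types (f g u : fps K) (a b : K).

(** * Shifted series and elementary determinants *)

(** The series [z^s f]. Read as [fps_shift j f i], it is also the entry [(i, j)] of the lower
    triangular Toeplitz matrix of [f]. *)
Definition fps_shift (s : nat) f (n : nat) : K :=
  if (s <= n)%N then f (n - s)%N else 0.

Lemma hankel_det_scale b f N :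
  hankel_det (fps_scale b f) N = b ^+ N * hankel_det f N.
Proof.
rewrite /hankel_det -detZ; congr (\det _).
by apply/matrixP => i j; rewrite !mxE.
Qed.

Lemma eq_hankel_det f g N : f =1 g -> hankel_det f N = hankel_det g N.
Proof.
move=> eq_fg; congr (\det _).
by apply/matrixP => i j; rewrite !mxE eq_fg.
Qed.

Lemma hankel_det_shift_eq0 s f N : (0 < N <= s)%N ->
  hankel_det (fps_shift s f) N = 0.
Proof.
case: N => // N /= leNs; rewrite /hankel_det (expand_det_row _ ord0) big1 // => j _.
by rewrite mxE /fps_shift leqNgt add0n (leq_trans (ltn_ord j) leNs) mul0r.
Qed.

(** Only the last entry of the first row survives in the expansion. Its minor is again
    antitriangular, and the signs add up by ['C(n.+1, 2) = 'C(n, 2) + n]. *)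
Lemma det_antitriangular n (A : 'M[K]_n) :
    (forall i j : 'I_n, ((i + j).+1 < n)%N -> A i j = 0) ->
    (forall i j : 'I_n, (i + j).+1 = n -> A i j = 1) ->
  \det A = (-1) ^+ 'C(n, 2).
Proof.
elim: n A => [|n IHn] A A0 A1; first by rewrite det_mx00.
rewrite (expand_det_row _ ord0) (bigD1 ord_max) //= big1 ?addr0 => [|j ne_j].
  rewrite A1 // mul1r /cofactor IHn => [|i j ltij|i j eqij].
  - by rewrite -exprD binS bin1 add0n addnC.
  - by rewrite !mxE A0 //= /bump; have := ltn_ord j; lia.
  - by rewrite !mxE A1 //= /bump; have := ltn_ord j; lia.
rewrite A0 ?mul0r //= add0n ltnS.
by have := ltn_ord j; move: ne_j; rewrite -val_eqE /=; lia.
Qed.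

Lemma det_toeplitz f N : f 0%N = 1 ->
  \det (\matrix_(i < N, j < N) fps_shift j f i) = 1.
Proof.
move=> f0; rewrite det_trig.
  by rewrite big1 // => i _; rewrite mxE /fps_shift leqnn subnn.
by apply/is_trig_mxP => i j ltij; rewrite mxE /fps_shift leqNgt ltij.
Qed.

(** * Factorization of the Hankel matrix of a shifted series *)

(** The entries of [C], indexed by all naturals so that sums over a row may run past the matrix
    size. *)
Definition hankel_core (s : nat) u (i j : nat) : K :=
  if (i <= s)%N then (if (j <= s)%N then fps_shift s u (i + j) else 0)
  else if (j <= s)%N then 0 else - u (i + j - s)%N.

(* After the substitutions [t = i - k] and [t = i + j - s], both sides are
   pieces of the coefficient of index [i + l - s] of [u f]: the same piece if
   [i <= s], complementary pieces of a vanishing coefficient otherwise. *)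
Lemma hankel_core_factor s u f N i l : fps_mul u f =1 fps_one ->
    (i < N)%N -> (l < N)%N ->
  \sum_(k < N) fps_shift k u i * fps_shift s f (k + l)
  = \sum_(j < N) hankel_core s u i j * fps_shift j f l.
Proof.
move=> uf1 ltiN ltlN.
(* The test replaces by 0 the terms for which [i + l - s - t] would be truncated. *)
pose G (t : nat) := if (s + t <= i + l)%N then u t * f (i + l - s - t)%N else 0.
have -> : \sum_(k < N) fps_shift k u i * fps_shift s f (k + l)
    = \sum_(0 <= t < i.+1) G t.
  rewrite -(big_mkord xpredT (fun k => fps_shift k u i * fps_shift s f (k + l))).
  rewrite (big_cat_nat (n := i.+1)) //= [X in _ + X]big1_seq ?addr0; last first.
    move=> k /=; rewrite mem_index_iota => /andP[ltik _].
    by rewrite /fps_shift leqNgt ltik mul0r.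
  rewrite big_nat_rev; apply: eq_big_nat => t /andP[_ ltti].
  rewrite add0n /fps_shift /G subSS leq_subr subKn //.
  have -> : (s <= i - t + l)%N = (s + t <= i + l)%N by lia.
  by case: ifP => _; rewrite ?mulr0 //; congr (_ * f _); lia.
rewrite -(big_mkord xpredT (fun j => hankel_core s u i j * fps_shift j f l)).
have [leis | ltsi] := leqP i s.
  transitivity (\sum_((s - i)%N <= j < s.+1) G (i + j - s)%N).
    rewrite -[(s - i)%N]add0n big_addn.
    have -> : (s.+1 - (s - i) = i.+1)%N by lia.
    apply: eq_big_nat => t _; congr G; lia.
  (* Row [i] is supported on [s - i <= j <= s], which may exceed the range [j < N]. The terms added
     up to [M] vanish because [l < N <= j]. *)
  pose M := maxn N s.+1.
  have supp j : ~~ (s - i <= j < s.+1)%N -> hankel_core s u i j = 0.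
    rewrite /hankel_core leis /fps_shift => nj.
    by case: ifP => // lejs; case: ifP => // lesij; lia.
  transitivity (\sum_(0 <= j < M) hankel_core s u i j * fps_shift j f l).
    rewrite [RHS](big_cat_nat (n := (s - i)%N)) //=; last by lia.
    rewrite [X in _ = X + _]big1_seq ?add0r; last first.
      move=> j /=; rewrite mem_index_iota => ltj.
      by rewrite supp ?mul0r //; lia.
    rewrite [RHS](big_cat_nat (n := s.+1)) //=; try lia.
    rewrite [X in _ = _ + X]big1_seq ?addr0; last first.
      move=> j /=; rewrite mem_index_iota => ltj.
      by rewrite supp ?mul0r //; lia.
    apply: eq_big_nat => j /andP[lej ltj].
    rewrite /hankel_core leis -ltnS ltj /fps_shift /G.
    have -> : (s <= i + j)%N by lia.
    have -> : (s + (i + j - s) <= i + l)%N = (j <= l)%N by lia.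
    by case: ifP => _; rewrite ?mulr0 //; congr (_ * f _); lia.
  rewrite (big_cat_nat (n := N)) //=; last by lia.
  rewrite [X in _ + X]big1_seq ?addr0 // => j /=; rewrite mem_index_iota => ltj.
  by rewrite /fps_shift leqNgt (leq_trans ltlN) ?mulr0 //; lia.
(* Here [i > s], so this is a coefficient of [u f = 1] of positive index. The range contains every
   [t <= i + l - s] because [l < N]. *)
have G0 : \sum_(0 <= t < (i + N - s)%N) G t = 0.
  have [ltil|leil] := leqP s (i + l); last by lia.
  rewrite (big_cat_nat (n := (i + l - s).+1)) //=; last by lia.
  rewrite [X in _ + X]big1_seq ?addr0 => [|t /=]; last first.
    by rewrite mem_index_iota /G => ltt; case: ifP => //; lia.
  have := uf1 (i + l - s)%N; rewrite /fps_one /fps_monom.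
  have -> : (i + l - s == 0)%N = false by lia.
  rewrite mulr0n /fps_mul -(big_mkord xpredT (fun t => u t * f (i + l - s - t)%N)).
  move=> uf0; rewrite -[RHS]uf0.
  by apply: eq_big_nat => t ltt; rewrite /G; case: ifP => //; lia.
have [leNs|ltsN] := leqP N s; first by lia.
rewrite [RHS](big_cat_nat (n := s.+1)) //= [X in _ = X + _]big1_seq ?add0r; last first.
  move=> j /=; rewrite mem_index_iota => /andP[_ ltj].
  by rewrite /hankel_core leqNgt ltsi -ltnS ltj mul0r.
apply/eqP; rewrite -subr_eq0; apply/eqP.
rewrite -[RHS]G0 [RHS](big_cat_nat (n := i.+1)) //=; last by lia.
congr (_ + _); rewrite -sumrN.
have -> : i.+1 = (s.+1 + (i - s))%N by lia.
rewrite big_addn; have -> : (i + N - s - (i - s) = N)%N by lia.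
apply: eq_big_nat => j /andP[lesj ltj].
rewrite /hankel_core leqNgt ltsi leqNgt lesj /= mulNr opprK /fps_shift /G.
have -> : (s + (j + (i - s)) <= i + l)%N = (j <= l)%N by lia.
case: ifP => lejl; last by rewrite mulr0.
by congr (u _ * f _); lia.
Qed.

Lemma hankel_det_shift s u f n : u 0%N = 1 -> f 0%N = 1 -> fps_mul u f =1 fps_one ->
  hankel_det (fps_shift s f) (s.+1 + n)
  = (-1) ^+ 'C(s.+1, 2) * hankel_det (fun k => - u (k + s.+2)%N) n.
Proof.
move=> u0 f0 uf1; set N := (s.+1 + n)%N.
pose L : 'M[K]_N := \matrix_(i, j) fps_shift j u i.
pose F : 'M[K]_N := \matrix_(i, j) fps_shift j f i.
pose C : 'M[K]_N := \matrix_(i, j) hankel_core s u i j.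
pose H : 'M[K]_N := \matrix_(i, j) fps_shift s f (i + j).
have LH : L *m H = C *m F^T.
  apply/matrixP => i l; rewrite !mxE.
  under eq_bigr do rewrite !mxE.
  under [RHS]eq_bigr do rewrite !mxE.
  exact: hankel_core_factor.
have -> : hankel_det (fps_shift s f) N = \det C.
  have := congr1 determinant LH.
  by rewrite !det_mulmx det_tr !det_toeplitz // mul1r mulr1.
pose A : 'M[K]_s.+1 := \matrix_(i, j) fps_shift s u (i + j).
(* The second block starts at row and column [s + 1], where the index is [2 (s + 1) - s = s + 2]. *)
pose B : 'M[K]_n := \matrix_(i, j) - u (i + j + s.+2)%N.
have le_s (k : 'I_s.+1) : (k <= s)%N by rewrite -ltnS.
have gt_s (k : 'I_n) : (s.+1 + k <= s)%N = false by lia.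
have -> : C = block_mx A 0 0 B.
  rewrite -[C]submxK; congr block_mx; apply/matrixP => i j; rewrite !mxE /hankel_core /=.
  - by rewrite !le_s.
  - by rewrite le_s gt_s.
  - by rewrite gt_s le_s.
  - by rewrite !gt_s; congr (- u _); lia.
rewrite det_ublock; congr (_ * _).
apply: det_antitriangular => i j ij; rewrite mxE /fps_shift.
  by case: ifP => //; lia.
by have -> : (i + j = s)%N by [apply: succn_inj]; rewrite leqnn subnn.
Qed.

(** * The inverse series of [f] *)

Definition fm_inv (m : nat) a b f (n : nat) : K :=
  (n == 0%N)%:R - a * (n == 1%N)%:R - b * fps_shift m f n.

(** This is the defining equation rearranged as [f - a z f - b z^m f^2 = 1]. *)
Lemma fm_inv_mul m a b f : (0 < m)%N -> is_fm m a b f ->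
  fps_mul (fm_inv m a b f) f =1 fps_one.
Proof.
move=> m_gt0 fE n.
have -> : fps_mul (fm_inv m a b f) f n
    = fps_mul 'z^0 f n - a * fps_mul 'z^1 f n - b * fps_mul (fps_shift m f) f n.
  rewrite /fps_mul !mulr_sumr -!sumrB; apply: eq_bigr => i _.
  by rewrite /fm_inv /fps_monom; ring.
have -> : fps_mul 'z^0 f n = f n.
  rewrite /fps_mul big_ord_recl /= mul1r subn0 big1 ?addr0 // => i _.
  by rewrite /fps_monom /= mul0r.
(* Associativity [(z^m f) f = z^m (f f)], by reindexing the convolution by [m]. *)
have -> : fps_mul (fps_shift m f) f n = fps_mul 'z^m (fps_mul f f) n.
  rewrite fps_mul_monom // /fps_mul.
  rewrite -(big_mkord xpredT (fun i => fps_shift m f i * f (n - i)%N)).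
  case: leqP => [lemn|ltnm]; last first.
    rewrite big1_seq // => i /=; rewrite mem_index_iota => lti.
    by rewrite /fps_shift; case: ifP; rewrite ?mul0r //; lia.
  rewrite (big_cat_nat (n := m)) //=; last by lia.
  rewrite [X in X + _]big1_seq ?add0r => [|i /=]; last first.
    rewrite mem_index_iota => lti.
    by rewrite /fps_shift; case: ifP; rewrite ?mul0r //; lia.
  rewrite -{1}[m]add0n big_addn subSn // big_mkord; apply: eq_bigr => i _.
  by rewrite /fps_shift leq_addl addnK; congr (_ * f _); lia.
rewrite fE /fm_rhs /fps_add /fps_scale; ring.
Qed.

Lemma fm0 m a b f : (0 < m)%N -> is_fm m a b f -> f 0%N = 1.
Proof.
move=> m_gt0 fE; rewrite fE /fm_rhs /fps_add /fps_scale !fps_mul_monom //.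
by rewrite [(m <= 0)%N]leqNgt m_gt0 /= !mulr0 !addr0.
Qed.

Lemma fm_inv0 m a b f : (0 < m)%N -> fm_inv m a b f 0%N = 1.
Proof.
by move=> m_gt0; rewrite /fm_inv /fps_shift leqNgt m_gt0 /= !mulr0 !subr0.
Qed.

Lemma hankel_det0 f : hankel_det f 0%N = 1.
Proof. exact: det_mx00. Qed.

(** * Recursion and closed forms for the Hankel determinants *)

(** Case [s = 0]: the antitriangular block is the single entry 1, and the coefficients of [-u] from
    index 2 on are those of [b z^(m-2) f]. *)
Lemma hankel_det_fmS m a b f n : (2 <= m)%N -> is_fm m a b f ->
  hankel_det f n.+1 = b ^+ n * hankel_det (fps_shift (m - 2) f) n.
Proof.
move=> m_ge2 fE; have m_gt0 : (0 < m)%N by lia.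
have -> : hankel_det f n.+1 = hankel_det (fps_shift 0 f) (1 + n).
  by apply: eq_hankel_det => k; rewrite /fps_shift subn0.
rewrite (@hankel_det_shift _ (fm_inv m a b f)) ?fm_inv0 ?(fm0 m_gt0 fE) //; last first.
  exact: fm_inv_mul.
rewrite bin_small // expr0 mul1r -hankel_det_scale; apply: eq_hankel_det => k.
rewrite /fm_inv /fps_scale /fps_shift.
have -> : (k + 2 == 0)%N = false by lia.
have -> : (k + 2 == 1)%N = false by lia.
have -> : (m <= k + 2)%N = (m - 2 <= k)%N by lia.
have -> : (k + 2 - m = k - (m - 2))%N by lia.
by rewrite !mulr0n mulr0 subr0 sub0r opprK.
Qed.

(** The first reduction gives [b ^+ (m - 1 + n)]. The second, with [s = m - 2], splits off an
    antitriangular block of size [m - 1], which gives the sign, and leaves [b ^+ n]. *)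
Lemma hankel_det_fm_addm m a b f n : (2 <= m)%N -> is_fm m a b f ->
  hankel_det f (m + n)
  = (-1) ^+ 'C(m - 1, 2) * b ^+ (m + n.*2 - 1) * hankel_det f n.
Proof.
move=> m_ge2 fE; have m_gt0 : (0 < m)%N by lia.
have -> : (m + n = ((m - 2).+1 + n).+1)%N by lia.
rewrite (hankel_det_fmS _ m_ge2 fE).
rewrite (@hankel_det_shift _ (fm_inv m a b f)) ?fm_inv0 ?(fm0 m_gt0 fE) //; last first.
  exact: fm_inv_mul.
have -> : hankel_det (fun k => - fm_inv m a b f (k + (m - 2).+2)) n
    = b ^+ n * hankel_det f n.
  rewrite -hankel_det_scale; apply: eq_hankel_det => k.
  rewrite /fm_inv /fps_scale /fps_shift.
  have -> : (k + (m - 2).+2 = k + m)%N by lia.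
  have -> : (k + m == 0)%N = false by lia.
  have -> : (k + m == 1)%N = false by lia.
  by rewrite leq_addl addnK !mulr0n mulr0 subr0 sub0r opprK.
have -> : ((m - 2).+1 = m - 1)%N by lia.
have -> : (m + n.*2 - 1 = (m - 1 + n) + n)%N by lia.
by rewrite [b ^+ (m - 1 + n + n)]exprD; ring.
Qed.

Lemma hankel_det_fm_mul m a b f n : (2 <= m)%N -> is_fm m a b f ->
  hankel_det f (m * n) = (-1) ^+ ('C(m - 1, 2) * n) * b ^+ (n * (m * n - 1)).
Proof.
move=> m_ge2 fE; elim: n => [|n IHn].
  by rewrite !muln0 ?mul0n !expr0 mulr1 hankel_det0.
rewrite mulnS (hankel_det_fm_addm _ m_ge2 fE) IHn mulnS.
have -> : (n.+1 * (m + m * n - 1) = (m + (m * n).*2 - 1) + n * (m * n - 1))%N.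
  (* At [n = 0] the subtraction in [m * n - 1] truncates, hence the separate case. *)
  by case: n {IHn} => [|n]; nia.
by rewrite !exprD; ring.
Qed.

Lemma hankel_det_fm_mul1 m a b f n : (2 <= m)%N -> is_fm m a b f ->
  hankel_det f (m * n + 1) = (-1) ^+ ('C(m - 1, 2) * n) * b ^+ (n * (m * n + 1)).
Proof.
move=> m_ge2 fE; elim: n => [|n IHn].
  rewrite !muln0 ?mul0n !expr0 mulr1 (hankel_det_fmS _ m_ge2 fE).
  by rewrite hankel_det0 mulr1.
rewrite mulnS -addnA (hankel_det_fm_addm _ m_ge2 fE) IHn mulnS.
have -> : (n.+1 * (m + (m * n + 1)) = (m + (m * n + 1).*2 - 1) + n * (m * n + 1))%N.
  by nia.
by rewrite !exprD; ring.
Qed.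

(** Removing [m] repeatedly leads to [2 <= N < m]. One reduction then gives the matrix of
    [z^(m-2) f] of size [N - 1 <= m - 2], whose first row is zero. *)
Lemma hankel_det_fm_eq0 m a b f N : (2 <= m)%N -> is_fm m a b f ->
    (forall n : nat, N <> (m * n)%N /\ N <> (m * n + 1)%N) ->
  hankel_det f N = 0.
Proof.
move=> m_ge2 fE; elim/ltn_ind: N => N IHN notN.
have [ltNm|lemN] := ltnP N m.
  (* The instance [n = 0] excludes [N = 0] and [N = 1]. *)
  have [] := notN 0%N; case: N ltNm {IHN notN} => [|[|N]] ltNm; try lia.
  move=> _ _; rewrite (hankel_det_fmS _ m_ge2 fE) hankel_det_shift_eq0 ?mulr0 //.
  by lia.
rewrite -(subnKC lemN) (hankel_det_fm_addm _ m_ge2 fE) IHN ?mulr0 //; first by lia.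
by move=> n; have := notN n.+1; rewrite mulnS; lia.
Qed.

End Hankel.

Theorem theorem7p1 (R : realType) (m : nat) (hm : (2 <= m)%N) (a b : R[i])
    (f : fps R[i]) (hf : is_fm m a b f) :
  [/\ forall n : nat,
        hankel_det f (m * n) = (-1) ^+ ('C(m - 1, 2) * n) * b ^+ (n * (m * n - 1)),
      forall n : nat,
        hankel_det f (m * n + 1) = (-1) ^+ ('C(m - 1, 2) * n) * b ^+ (n * (m * n + 1))
    & forall N : nat, (forall n : nat, N <> (m * n)%N /\ N <> (m * n + 1)%N) ->
        hankel_det f N = 0].
Proof.
split=> [n|n|N notN]; first exact: hankel_det_fm_mul.
  exact: hankel_det_fm_mul1.
exact: hankel_det_fm_eq0 hf notN.
Qed.
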